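(* For integers $k \ge 1$, $w_k \ge 0$ and $n \ge 1$, there is an $O(k \log k \log n + w_k)$-bit adjacency labeling scheme for the family of all $w_k$-probe $\mathcal{C}_k$-graphs on a vertex set of size $n$, where $\mathcal{C}_k$ is the family of graphs of clique-width at most $k$. That is, there is an absolute constant $C>0$ such that for all $k, w_k, n$ this family has an $L$-bit adjacency labeling scheme with $L \le C\,(k \log_2 k \,\log_2 n + w_k)$.
   Context: All graphs are finite, undirected, without self-loops or parallel edges. For a graph $G=(V,E)$ and $u,v \in V$, put $\mathsf{adj}(u,v) = 1$ if $\{u,v\}\in E$ and $\mathsf{adj}(u,v)=0$ otherwise. Adjacency labeling scheme: let $\mathcal{F}_n$ be a family of graphs on the vertex set $V$, $|V| = n$. An $L$-bit adjacency labeling scheme of $\mathcal{F}_n$ is a pair of functions $\mathsf{enc}: \mathcal{F}_n \to (V \to \{0,1\}^L)$ and $\mathsf{dec}: \{0,1\}^L \times \{0,1\}^L \to \{0,1\}$ such that for all $G = (V,E)\in \mathcal{F}_n$ and all $u,v\in V$, $\mathsf{adj}(u,v) = \mathsf{dec}(\mathsf{enc}(G)(u), \mathsf{enc}(G)(v))$. (So $\mathsf{dec}$ may depend on the family, but not on the individual graph $G$.) Clique-width: the clique-width of a graph $G$ is the minimum number of vertex labels needed to construct $G$ using the following four operations on vertex-labeled graphs: (1) create a single vertex $v$ with label $i$; (2) disjoint union $G_1 \oplus G_2$ of two labeled graphs; (3) join $\eta_{i,j}$ with $i\neq j$, which adds an edge between every pair of vertices one of which has label $i$ and the other label $j$; (4)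 relabel $\rho_{i\to j}$, which changes the label of all vertices with label $i$ to label $j$. $\mathcal{F}$-width and probe graphs: let $\mathcal{F}$ be a family of graphs. The $\mathcal{F}$-width of a graph $G=(V,E)$ is the minimum number $w$ of independent sets $N_1,\ldots,N_w$ in $G$ such that there exists $H=(V,E')\in\mathcal{F}$ for which (1) $G$ is a spanning subgraph of $H$ (i.e. $E\subseteq E'$), and (2) for every edge $\{u,v\}\in E'\setminus E$ there exists $i\in\{1,\ldots,w\}$ with $u,v\in N_i$. A graph whose $\mathcal{F}$-width is $w$ is called a $w$-probe $\mathcal{F}$-graph. *)

(* Defs.v *)
From mathcomp Require Import all_boot all_order all_algebra.
From mathcomp Require Import reals exp.

Set Implicit Arguments.
Unset Strict Implicit.
Unset Printing Implicit Defensive.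

Record sgraph (V : finType) := SGraph {
  adj : rel V;
  adj_sym : symmetric adj;
  adj_irrefl : irreflexive adj }.

(* A family containing graphs on every finite vertex set. *)
Definition graph_family := forall V : finType, sgraph V -> Prop.

Definition independent (V : finType) (G : sgraph V) (N : {set V}) : Prop :=
  forall u v, u \in N -> v \in N -> ~~ adj G u v.

Definition is_minimum (P : nat -> Prop) (m : nat) : Prop :=
  P m /\ forall m', P m' -> m <= m'.

(* Graphs with vertices labeled by k labels.  The vertex set is part of the
   data, so that disjoint union is the union on the sum type. *)
Record lgraph (k : nat) := LGraph {
  lg_vert : finType;
  lg_graph : sgraph lg_vert;
  lg_lab : lg_vert -> 'I_k }.

Section Operations.
Variable k : nat.
Implicit Types (A B : lgraph k) (i j : 'I_k).

Fact lg_single_sym : symmetric (fun _ _ : unit => false).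
Proof. by []. Qed.

Fact lg_single_irrefl : irreflexive (fun _ _ : unit => false).
Proof. by []. Qed.

Definition lg_single i : lgraph k :=
  LGraph (SGraph lg_single_sym lg_single_irrefl) (fun _ => i).

Definition union_adj A B (x y : lg_vert A + lg_vert B) : bool :=
  match x, y with
  | inl u, inl v => adj (lg_graph A) u v
  | inr u, inr v => adj (lg_graph B) u v
  | _, _ => false
  end.

Fact union_adj_sym A B : symmetric (@union_adj A B).
Proof. by move=> [u|u] [v|v] //=; apply: adj_sym. Qed.

Fact union_adj_irrefl A B : irreflexive (@union_adj A B).
Proof. by move=> [u|u] /=; apply: adj_irrefl. Qed.

Definition lg_union A B : lgraph k :=
  LGraph (SGraph (@union_adj_sym A B) (@union_adj_irrefl A B))
    (fun x => match x with inl u => lg_lab u | inr u => lg_lab u end).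

Definition join_adj i j A (u v : lg_vert A) : bool :=
  [|| adj (lg_graph A) u v,
      (lg_lab u == i) && (lg_lab v == j)
    | (lg_lab u == j) && (lg_lab v == i)].

Fact join_adj_sym i j A : symmetric (@join_adj i j A).
Proof.
move=> u v; rewrite /join_adj adj_sym; congr (_ || _).
by rewrite orbC; congr (_ || _); rewrite andbC.
Qed.

Fact join_adj_irrefl i j A : i != j -> irreflexive (@join_adj i j A).
Proof.
move=> nij u; rewrite /join_adj adj_irrefl /=.
by case: (lg_lab u =P i) => [->|_]; rewrite ?(negbTE nij) ?andbF.
Qed.

Definition lg_join i j (nij : i != j) A : lgraph k :=
  LGraph (SGraph (@join_adj_sym i j A) (join_adj_irrefl (A := A) nij))
    (@lg_lab k A).

Definition lg_relabel i j A : lgraph k :=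
  LGraph (lg_graph A) (fun u => if lg_lab u == i then j else lg_lab u).

End Operations.

Inductive cw_built (k : nat) : lgraph k -> Prop :=
| CwSingle i : cw_built (lg_single i)
| CwUnion A B : cw_built A -> cw_built B -> cw_built (lg_union A B)
| CwJoin i j (nij : i != j) A : cw_built A -> cw_built (lg_join nij A)
| CwRelabel i j A : cw_built A -> cw_built (lg_relabel i j A).

(* Since the operations produce their own vertex set, G is constructed up to
   a bijection from its vertex set V. *)
Definition constructible_with (V : finType) (G : sgraph V) (k : nat) : Prop :=
  exists A : lgraph k, cw_built A /\
  exists f : V -> lg_vert A, bijective f /\
    forall u v, adj G u v = adj (lg_graph A) (f u) (f v).

Definition has_clique_width (V : finType) (G : sgraph V) (c : nat) : Prop :=
  is_minimum (constructible_with G) c.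

Definition cw_family (k : nat) : graph_family :=
  fun V G => exists2 c, has_clique_width G c & c <= k.

Definition probe_witness (F : graph_family) (V : finType) (G : sgraph V)
    (w : nat) : Prop :=
  exists N : 'I_w -> {set V}, (forall i, independent G (N i)) /\
  exists H : sgraph V, [/\ F V H,
    forall u v, adj G u v -> adj H u v &
    forall u v, adj H u v -> ~~ adj G u v ->
      exists i, u \in N i /\ v \in N i].

Definition has_family_width (F : graph_family) (V : finType) (G : sgraph V)
    (w : nat) : Prop :=
  is_minimum (probe_witness F G) w.

Definition probe_family (w : nat) (F : graph_family) : graph_family :=
  fun V G => has_family_width F G w.

(* Values of enc outside the family Fn are irrelevant. *)
Definition is_labeling_scheme (V : finType) (Fn : sgraph V -> Prop) (L : nat)
    (enc : sgraph V -> V -> L.-tuple bool)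
    (dec : L.-tuple bool * L.-tuple bool -> bool) : Prop :=
  forall G, Fn G -> forall u v, adj G u v = dec (enc G u, enc G v).

Definition has_labeling_scheme (V : finType) (Fn : sgraph V -> Prop)
    (L : nat) : Prop :=
  exists enc dec, is_labeling_scheme (L := L) Fn enc dec.

Definition log2 (R : realType) (x : R) : R := (ln x / ln 2)%R.

(* Main.v *)
(* If G is a probe graph with supergraph H and independent sets N_i, then u and
   v are adjacent in G iff they are adjacent in H and no N_i contains both, so w
   bits per vertex reduce the problem to H.  In a k-expression for H, the
   vertices below a node fall into k classes of twins with respect to the
   vertices outside of it; by descending towards the larger operand, any vertex
   set S is split by such a node into two parts of size at most 2|S|/3.  At each
   of the O(log n) levels of the resulting recursion a vertex stores k + 1 bits:
   its side and a set of classes (its own class on the inner side, the adjacent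
   classes on the outer side); two vertices that get separated are adjacent iff
   their sets meet. *)
Require Import Defs.
From mathcomp Require Import all_boot all_order all_algebra.
From mathcomp Require Import reals exp.
From mathcomp Require Import zify lra.

Set Implicit Arguments.
Unset Strict Implicit.
Unset Printing Implicit Defensive.

(** * Splitting a vertex set along a clique-width expression *)

Lemma card_set_sum (T1 T2 : finType) (S : {set T1 + T2}) :
  #|S| = #|inl @^-1: S| + #|inr @^-1: S|.
Proof.
rewrite -!sum1_card big_mkcond big_sumType /=.
by congr (_ + _); rewrite -big_mkcond; apply: eq_bigl => x; rewrite inE.
Qed.

Lemma card_setI_imset (T1 T2 : finType) (h : T1 -> T2) (S : {set T2})
    (T : {set T1}) :
  injective h -> #|S :&: h @: T| = #|h @^-1: S :&: T|.
Proof.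
move=> inj_h; rewrite -(card_imset _ inj_h); congr #|pred_of_set _|.
apply/setP=> y; rewrite inE; apply/andP/imsetP.
  by move=> [yS /imsetP[x xT def_y]]; exists x; rewrite // !inE -def_y yS.
by move=> [x /[!inE] /andP[xS xT] ->]; rewrite xS imset_f.
Qed.

(** The cut between [T] and its complement has at most [k] distinct rows; the values of [alpha] off
    [T] are irrelevant. *)
Definition twin_classes (V : finType) (G : sgraph V) (k : nat) (T : {set V})
    (alpha : V -> 'I_k) : Prop :=
  forall a a' b, a \in T -> a' \in T -> b \notin T -> alpha a = alpha a' ->
  adj G a b = adj G a' b.

(* Besides being twins, equivalent vertices must carry the same label, so that
   the operations applied further up keep treating them alike. *)
Definition twin_module (k : nat) (A : lgraph k) (T : {set lg_vert A})
    (alpha : lg_vert A -> 'I_k) : Prop :=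
  twin_classes (lg_graph A) T alpha /\
  forall a a', a \in T -> a' \in T -> alpha a = alpha a' ->
  lg_lab a = lg_lab a'.

Section TwinModules.
Variable k : nat.
Implicit Types A B : lgraph k.

Lemma twin_module_inl A B (T : {set lg_vert A}) alpha :
  twin_module T alpha ->
  exists beta, @twin_module k (lg_union A B) (inl @: T) beta.
Proof.
move=> [adjT labT].
(* [lg_lab v] is a filler: no class is prescribed off [T], but ['I_k] has no default element. *)
exists (fun x => match x with inl u => alpha u | inr v => lg_lab v end).
split.
  move=> _ _ [b|b] /imsetP[a aT ->] /imsetP[a' a'T ->] //=.
  rewrite mem_imset; last by move=> ? ? [].
  exact: adjT.
by move=> _ _ /imsetP[a aT ->] /imsetP[a' a'T ->] /=; apply: labT.
Qed.

Lemma twin_module_inr A B (T : {set lg_vert B}) alpha :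
  twin_module T alpha ->
  exists beta, @twin_module k (lg_union A B) (inr @: T) beta.
Proof.
move=> [adjT labT].
exists (fun x => match x with inl u => lg_lab u | inr v => alpha v end).
split.
  move=> _ _ [b|b] /imsetP[a aT ->] /imsetP[a' a'T ->] //=.
  rewrite mem_imset; last by move=> ? ? [].
  exact: adjT.
by move=> _ _ /imsetP[a aT ->] /imsetP[a' a'T ->] /=; apply: labT.
Qed.

Lemma twin_module_setT A : twin_module [set: lg_vert A] (@lg_lab k A).
Proof. by split=> // a a' b _ _; rewrite inE. Qed.

(** A join treats a vertex according to its label alone, and equivalent vertices share theirs. *)
Lemma twin_module_join i j (nij : i != j) A (T : {set lg_vert A}) alpha :
  twin_module T alpha -> @twin_module k (lg_join nij A) T alpha.
Proof.
move=> [adjT labT]; split=> // a a' b aT a'T bT eq_a /=.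
by rewrite /join_adj (labT a a') // (adjT a a' b).
Qed.

Lemma twin_module_relabel i j A (T : {set lg_vert A}) alpha :
  twin_module T alpha -> @twin_module k (lg_relabel i j A) T alpha.
Proof.
by move=> [adjT labT]; split=> // a a' aT a'T eq_a /=; rewrite (labT a a').
Qed.

(** At a union, descend into an operand with more than [t] vertices of [S]. If neither has that
    many, the larger one, taken whole with its labels as classes, has more than [t / 2] of them. *)
Lemma cw_built_split A : cw_built A ->
  forall (S : {set lg_vert A}) t, 0 < t < #|S| ->
  exists T, (exists alpha, twin_module T alpha) /\
    #|S :&: T| <= t < 2 * #|S :&: T|.
Proof.
elim=> {A} [i|A B _ IHA _ IHB|i j nij A _ IHA|i j A _ IHA] S t tS.
- have S1 : #|S| <= 1 by rewrite -card_unit; exact: max_card.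
  by case/andP: tS => t0 /leq_trans/(_ S1); lia.
- case/andP: tS => t0 tS.
  have inj_l : injective (@inl (lg_vert A) (lg_vert B)) by move=> ? ? [].
  have inj_r : injective (@inr (lg_vert A) (lg_vert B)) by move=> ? ? [].
  have tS' : t < #|inl @^-1: S| + #|inr @^-1: S| by rewrite -card_set_sum.
  case: (ltnP t #|inl @^-1: S|) => [tSl|Slt].
    have [|T [[alpha mT] cT]] := IHA (inl @^-1: S) t; first by rewrite t0.
    exists (inl @: T); split; first exact: twin_module_inl mT.
    by rewrite card_setI_imset.
  case: (ltnP t #|inr @^-1: S|) => [tSr|Srt].
    have [|T [[alpha mT] cT]] := IHB (inr @^-1: S) t; first by rewrite t0.
    exists (inr @: T); split; first exact: twin_module_inr mT.
    by rewrite card_setI_imset.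
  case: (leqP #|inl @^-1: S| #|inr @^-1: S|) => Slr.
    exists (inr @: setT).
    split; first exact: twin_module_inr (twin_module_setT B).
    have tS2 : t < 2 * #|inr @^-1: S| by lia.
    by rewrite card_setI_imset // setIT Srt.
  have tS2 : t < 2 * #|inl @^-1: S| by lia.
  exists (inl @: setT).
  split; first exact: twin_module_inl (twin_module_setT A).
  by rewrite card_setI_imset // setIT Slt.
- have [T [[alpha mT] cT]] := IHA S t tS.
  by exists T; split=> //; exists alpha; apply: twin_module_join.
- have [T [[alpha mT] cT]] := IHA S t tS.
  by exists T; split=> //; exists alpha; apply: twin_module_relabel.
Qed.

End TwinModules.

(** * The balanced recursion *)

Section BalancedScheme.
Variable k : nat.

(** In the labelings built below, labels of vertices of [S] that agree in all side bits belong to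
    one vertex, hence the default [false]. *)
Fixpoint separation_dec (s t : seq (bool * {set 'I_k})) : bool :=
  match s, t with
  | (a, X) :: s', (b, Y) :: t' =>
      if a == b then separation_dec s' t' else X :&: Y != set0
  | _, _ => false
  end.

Lemma separation_dec_refl s : separation_dec s s = false.
Proof. by elim: s => [|[a X] s IHs] //=; rewrite eqxx. Qed.

Definition separation_labeled (V : finType) (G : sgraph V) d (S : {set V}) :
    Prop :=
  exists l : V -> d.-tuple (bool * {set 'I_k}),
  {in S &, forall u v, adj G u v = separation_dec (l u) (l v)}.

Definition splittable (V : finType) (G : sgraph V) : Prop :=
  forall (S : {set V}) t, 0 < t < #|S| ->
  exists T, (exists alpha : V -> 'I_k, twin_classes G T alpha) /\
    #|S :&: T| <= t < 2 * #|S :&: T|.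

Lemma separation_labeled_card_le1 (V : finType) (G : sgraph V) d (S : {set V}) :
  #|S| <= 1 -> separation_labeled G d S.
Proof.
move=> S1; exists (fun=> [tuple of nseq d (false, set0)]) => u v uS vS.
by rewrite separation_dec_refl (card_le1_eqP S1 u v) // adj_irrefl.
Qed.

Lemma separation_labeledS (V : finType) (G : sgraph V) d (S T : {set V})
    (alpha : V -> 'I_k) :
  twin_classes G T alpha ->
  separation_labeled G d (S :&: T) -> separation_labeled G d (S :\: T) ->
  separation_labeled G d.+1 S.
Proof.
move=> twT [l1 dec1] [l2 dec2].
(* One neighbour of [u] in a class of [T] makes the whole class adjacent to [u], for [u] outside
   [T]. *)
pose nb u := [set i | [exists a in T, (alpha a == i) && adj G a u]].
have nbP a b : a \in T -> b \notin T -> adj G a b = (alpha a \in nb b).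
  move=> aT bT; rewrite inE; apply/idP/existsP => [ab|[a']].
    by exists a; rewrite aT eqxx.
  by case/and3P=> a'T /eqP eq_a a'b; rewrite (twT a a').
have set1I i (X : {set 'I_k}) : ([set i] :&: X != set0) = (i \in X).
  by rewrite setI_eq0 disjoints1 negbK.
exists (fun u => if u \in T then [tuple of (true, [set alpha u]) :: l1 u]
                 else [tuple of (false, nb u) :: l2 u]) => u v uS vS.
case: ifP => uT; case: ifP => vT /=.
- by apply: dec1; rewrite inE ?uS ?vS.
- by rewrite set1I nbP // vT.
- by rewrite setIC set1I adj_sym nbP // uT.
- by apply: dec2; rewrite inE ?uT ?vT.
Qed.

Lemma splittable_separation_labeled (V : finType) (G : sgraph V) :
  splittable G ->
  forall d (S : {set V}), #|S| * 2 ^ d <= 3 ^ d -> separation_labeled G d S.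
Proof.
move=> splG; elim=> [|d IHd] S leS.
  by apply: separation_labeled_card_le1; lia.
case: (leqP #|S| 1) => [S1|S2]; first exact: separation_labeled_card_le1.
(* With this [t], the part inside [T] has at most 2/3 of [S] and more than 1/3, so the rest is below
   2/3 as well. *)
have [|T [[alpha twT] cT]] := splG S (2 * #|S| %/ 3); first by lia.
have cS := cardsID T S.
have small c : 3 * c <= 2 * #|S| -> c * 2 ^ d <= 3 ^ d.
  move=> le_c; move: leS; rewrite !expnS.
  have := leq_mul le_c (leqnn (2 ^ d)); lia.
by apply: (separation_labeledS twT); apply: IHd; apply: small; lia.
Qed.

End BalancedScheme.

(** * Bit labels for probe graphs *)

Lemma constructible_splittable (V : finType) (G : sgraph V) c k :
  constructible_with G c -> c <= k -> splittable k G.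
Proof.
move=> [A [bA [f [[g fK gK] adjG]]]] le_ck S t tS.
have inj_f := can_inj fK.
have [|T [[alpha [twT _]] cT]] := cw_built_split bA (S := f @: S) (t := t).
  by rewrite card_imset.
exists (f @^-1: T); split.
  exists (fun u => widen_ord le_ck (alpha (f u))) => a a' b.
  rewrite !inE !adjG => aT a'T bT /(congr1 val) /= eq_a.
  by apply: twT => //; apply: val_inj.
by rewrite setIC card_setI_imset // in cT; rewrite setIC.
Qed.

Lemma labeling_scheme_of_finType (V D : finType) (Fn : sgraph V -> Prop) L
    (dec : D -> D -> bool) :
  #|D| <= 2 ^ L ->
  (forall G, Fn G ->
     exists l : V -> D, forall u v, adj G u v = dec (l u) (l v)) ->
  has_labeling_scheme Fn L.
Proof.
move=> leD lab.
have leD' : #|D| <= #|{: L.-tuple bool}| by rewrite card_tuple card_bool.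
pose code x := enum_val (widen_ord leD' (enum_rank x)) : L.-tuple bool.
have inj_code : injective code.
  move=> x y /enum_val_inj /(congr1 val) /= eq_xy.
  by apply: enum_rank_inj; apply: val_inj.
pose decode s := [pick x | code x == s].
have codeK x : decode (code x) = Some x.
  rewrite /decode; case: pickP => [y /eqP /inj_code -> //|/(_ x)].
  by rewrite eqxx.
(* The labelings are only known to exist; searching the finite type of functions selects one for
   each graph. The constant [false] string serves graphs without such a labeling. *)
exists (fun G u =>
  if [pick l : {ffun V -> D} | [forall u, forall v,
        adj G u v == dec (l u) (l v)]] is Some l
  then code (l u) else [tuple of nseq L false]).
exists (fun st => match decode st.1, decode st.2 with
  | Some x, Some y => dec x y | _, _ => false end).
move=> G /lab[l decG] u v; case: pickP => [l' /'forall_'forall_eqP ->|].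
  by rewrite !codeK.
move/(_ (finfun l))/'forall_'forall_eqP; case=> x y.
by rewrite !ffunE.
Qed.

Lemma probe_family_adj (F : graph_family) w (V : finType) (G : sgraph V) :
  probe_family w F G ->
  exists H, F V H /\ exists p : V -> {set 'I_w},
  forall u v, adj G u v = adj H u v && (p u :&: p v == set0).
Proof.
move=> [[N [indN [H [FH GH HN]]]] _]; exists H; split=> //.
exists (fun u => [set i | u \in N i]) => u v.
apply/idP/andP => [Guv|[Huv /eqP/setP disj]].
  split; first exact: GH.
  apply/eqP/setP => i; rewrite !inE; apply/andP => -[uN vN].
  by have := indN i u v uN vN; rewrite Guv.
apply/negPn/negP => nGuv; have [i [uN vN]] := HN u v Huv nGuv.
by have := disj i; rewrite !inE uN vN.
Qed.

Lemma probe_family_labeling_scheme k w d (V : finType) :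
  #|V| * 2 ^ d <= 3 ^ d ->
  has_labeling_scheme (@probe_family w (cw_family k) V) (k.+1 * d + w).
Proof.
move=> leV.
pose D := (d.-tuple (bool * {set 'I_k}) * {set 'I_w})%type.
apply: (@labeling_scheme_of_finType V D _ _
  (fun x y => separation_dec x.1 y.1 && (x.2 :&: y.2 == set0))).
  (* There are (2 * 2^k)^d * 2^w labels. *)
  rewrite card_prod card_tuple card_prod card_bool -!cardsT -!powersetT.
  by rewrite !card_powerset !cardsT !card_ord expnD expnM expnS.
move=> G /probe_family_adj[H [[c [constrH _] le_ck] [p adjG]]].
have splH := constructible_splittable constrH le_ck.
have [|l decH] := splittable_separation_labeled splH (d := d) (S := setT).
  by rewrite cardsT.
by exists (fun u => (l u, p u)) => u v; rewrite adjG decH ?inE.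
Qed.

(** Edges arise only from joins, which need two distinct labels. This serves the case [k = 1], where
    the target bound has no log n term. *)
Lemma cw_built_edgeless c (A : lgraph c) :
  cw_built A -> c <= 1 -> forall u v, adj (lg_graph A) u v = false.
Proof.
move=> bA c1; elim: bA => {A} // [A B _ IHA _ IHB [u|u] [v|v] //=|i j nij].
by case/eqP: nij; apply: val_inj => /=; have := ltn_ord i; have := ltn_ord j; lia.
Qed.

Lemma edgeless_labeling_scheme (V : finType) (Fn : sgraph V -> Prop) :
  (forall G, Fn G -> forall u v, adj G u v = false) -> has_labeling_scheme Fn 0.
Proof.
move=> edgeless; exists (fun _ _ => [tuple]), (fun=> false).
exact: edgeless.
Qed.

(** Two levels of the recursion more than halve the size, as (2/3)^2 < 1/2; in integers, 8^m <=
    9^m. *)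
Lemma leq_up_log_exp n : n * 2 ^ (2 * up_log 2 n) <= 3 ^ (2 * up_log 2 n).
Proof.
have up_n : n <= 2 ^ up_log 2 n by apply: up_logP.
apply: leq_trans (leq_mul up_n (leqnn _)) _.
rewrite !expnM -expnMn.
by case: (up_log 2 n) => [|m]; rewrite // leq_exp2r.
Qed.

(** * Logarithmic estimates and the final bound *)

Import Order.TTheory GRing.Theory Num.Theory.

Lemma ln2_gt0 (R : realType) : (0 < ln 2 :> R)%R.
Proof. by rewrite ln_gt0 // ltr1n. Qed.

Lemma log2_ge1 (R : realType) n : 2 <= n -> (1 <= log2 n%:R :> R)%R.
Proof.
move=> n2; rewrite /log2 ler_pdivlMr ?ln2_gt0 // mul1r.
by rewrite ler_ln ?posrE ?ltr0n ?ler_nat //; lia.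
Qed.

Lemma up_log_le_log2 (R : realType) n :
  2 <= n -> ((up_log 2 n)%:R <= log2 n%:R + 1 :> R)%R.
Proof.
move=> n2; have up_gt0 : 0 < up_log 2 n by rewrite up_log_gt0.
rewrite -(prednK up_gt0) -natr1 lerD2r /log2 ler_pdivlMr ?ln2_gt0 //.
rewrite mulr_natl -lnXn ?ltr0n // -natrX.
rewrite ler_ln ?posrE ?ltr0n ?expn_gt0 ?ler_nat; last 2 first.
- by [].
- by lia.
by apply: ltnW; apply: up_log_gtn.
Qed.

Theorem corollary1 (R : realType) :
  exists C : R, (0 < C)%R /\
  forall (k w n : nat), 1 <= k -> 1 <= n ->
  forall V : finType, #|V| = n ->
  exists L : nat,
    (L%:R <= C * (k%:R * log2 k%:R * log2 n%:R + w%:R))%R /\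
    has_labeling_scheme (@probe_family w (cw_family k) V) L.
Proof.
(* 8 = 2 * 4: once both logarithms are at least 1, k + 1 <= 2 k log k and the depth is at most 2
   (log n + 1) <= 4 log n. *)
exists 8%R; split=> // k w n k1 n1 V cardV.
have log2_1 : log2 1 = 0%R :> R by rewrite /log2 ln1 mul0r.
(* For [n = 1] or [k = 1] a logarithm vanishes and the bound is 8w; the graphs are edgeless, so
   empty labels suffice. *)
case: (leqP n 1) => [n_le1|n2].
  exists 0; split.
    by rewrite (_ : n = 1) ?log2_1 ?mulr0 ?add0r ?mulr_ge0 //; lia.
  apply: edgeless_labeling_scheme => G _ u v.
  by rewrite (_ : u = v) ?adj_irrefl //; apply/fintype_le1P; rewrite cardV.
case: (leqP k 1) => [k_le1|k2].
  exists 0; split.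
    by rewrite (_ : k = 1) ?log2_1 ?(mulr0, mul0r) ?add0r ?mulr_ge0 //; lia.
  apply: edgeless_labeling_scheme => G.
  move=> /probe_family_adj[H [[c [[A [bA [f [_ adjH]]]] _] le_ck] [p adjG]]] u v.
  by rewrite adjG adjH (cw_built_edgeless bA) //; lia.
exists (k.+1 * (2 * up_log 2 n) + w); split; last first.
  by apply: probe_family_labeling_scheme; rewrite cardV leq_up_log_exp.
have x1 := log2_ge1 R k2; have y1 := log2_ge1 R n2.
have le_up := up_log_le_log2 R n2.
have k1R : (1 <= k%:R :> R)%R by rewrite ler1n.
have w0 : (0 <= w%:R :> R)%R by [].
set x := log2 k%:R in x1 *; set y := log2 n%:R in y1 le_up *.
have kx : (k%:R <= k%:R * x)%R by rewrite ler_peMr // ler0n.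
have le_k : (k.+1%:R <= 2 * (k%:R * x) :> R)%R by rewrite -natr1; lra.
have le_m : ((2 * up_log 2 n)%:R <= 4 * y)%R by rewrite natrM; lra.
have := ler_pM (ler0n _ _) (ler0n _ _) le_k le_m.
by rewrite natrD natrM; lra.
Qed.
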